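(* Let $L$ be a finite dimensional Lie algebra over a field $k$ of characteristic zero. Then the solvable radical $R$ of $L$ coincides with the set of all $\overrightarrow{v}$-Engel elements of $L$.
   Context: The solvable radical of $L$ is the largest solvable ideal of $L$. The sequence $\overrightarrow{v}=v_1,v_2,\dots$ is defined by $v_1(x,y)=x$ and, inductively, $v_{n+1}(x,y)=[v_n(x,y),[x,y]]$ for $n\ge 1$, where $[\ ,\ ]$ is the Lie bracket. An element $y\in L$ is called $\overrightarrow{v}$-Engel if for every $x\in L$ there exists $n=n(x,y)\ge 1$ such that $v_n(x,y)=0$. *)

(* Defs.v *)
From HB Require Import structures.
From mathcomp Require Import all_boot all_order all_algebra.
From Stdlib Require Import Classical.

Set Implicit Arguments.
Unset Strict Implicit.
Unset Printing Implicit Defensive.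

Import GRing.Theory.

Local Open Scope ring_scope.

HB.mixin Record Lmodule_hasLieBracket (k : fieldType) L of GRing.Lmodule k L := {
  lie : L -> L -> L;
  lie_linearl : forall y : L, linear (fun x => lie x y);
  lie_linearr : forall x : L, linear (fun y => lie x y);
  liexx : forall x : L, lie x x = 0;
  lie_jacobi : forall x y z : L,
    lie x (lie y z) + lie y (lie z x) + lie z (lie x y) = 0
}.

#[short(type="lieAlgType")]
HB.structure Definition LieAlgebra (k : fieldType) :=
  { L of GRing.Lmodule k L & Lmodule_hasLieBracket k L }.

(* Finite dimensionality is the [vectType] structure. *)
#[short(type="finDimLieAlgType")]
HB.structure Definition FinDimLieAlgebra (k : fieldType) :=
  { L of Vector k L & Lmodule_hasLieBracket k L }.

Notation "[ 'lie' x , y ]" := (lie x y)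
  (at level 0, x, y at level 99, format "[ 'lie'  x ,  y ]") : ring_scope.

Section Bilinearity.

Variables (k : fieldType) (L : lieAlgType k).
Implicit Types x y z : L.

Lemma lieDl x y z : [lie x + y, z] = [lie x, z] + [lie y, z].
Proof. by have := lie_linearl z 1 x y; rewrite /= !scale1r. Qed.

Lemma lieDr x y z : [lie x, y + z] = [lie x, y] + [lie x, z].
Proof. by have := lie_linearr x 1 y z; rewrite /= !scale1r. Qed.

Lemma lie0l z : [lie 0, z] = 0.
Proof. by apply: (addrI [lie 0, z]); rewrite -lieDl !addr0. Qed.

Lemma lie0r z : [lie z, 0] = 0.
Proof. by apply: (addrI [lie z, 0]); rewrite -lieDr !addr0. Qed.

Lemma lieZl a x z : [lie a *: x, z] = a *: [lie x, z].
Proof. by have := lie_linearl z a x 0; rewrite /= lie0l !addr0. Qed.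

Lemma lieZr a x z : [lie x, a *: z] = a *: [lie x, z].
Proof. by have := lie_linearr x a z 0; rewrite /= lie0r !addr0. Qed.

Lemma lieC x y : [lie x, y] = - [lie y, x].
Proof.
apply/eqP; rewrite -addr_eq0; apply/eqP.
by have := liexx (x + y); rewrite lieDl !lieDr !liexx add0r addr0.
Qed.

Lemma lie_suml I (r : seq I) (P : pred I) (F : I -> L) z :
  [lie \sum_(i <- r | P i) F i, z] = \sum_(i <- r | P i) [lie F i, z].
Proof. by apply: (big_morph (lie^~ z)) => [x y|]; rewrite (lieDl, lie0l). Qed.

Lemma lie_sumr I (r : seq I) (P : pred I) (F : I -> L) z :
  [lie z, \sum_(i <- r | P i) F i] = \sum_(i <- r | P i) [lie z, F i].
Proof. by apply: (big_morph (lie z)) => [x y|]; rewrite (lieDr, lie0r). Qed.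

End Bilinearity.

Section Radical.

Variables (k : fieldType) (L : finDimLieAlgType k).
Implicit Types (x y : L) (U V W I J : {vspace L}).

(* The span of the brackets of basis vectors; [lie_prodvP] shows that this is
   the smallest subspace containing all [lie u, v] with u \in U and v \in V. *)
Definition lie_prodv U V : {vspace L} :=
  <<[seq [lie u, v] | u <- vbasis U, v <- vbasis V]>>%VS.

Definition lie_ideal I : Prop := forall x y, y \in I -> [lie x, y] \in I.

Definition lie_derived (n : nat) U : {vspace L} :=
  iter n (fun V => lie_prodv V V) U.

Definition lie_solvable U : Prop := exists n, lie_derived n U = 0%VS.

Definition is_solvable_radical (R : {vspace L}) : Prop :=
  [/\ lie_ideal R, lie_solvable R
    & forall I, lie_ideal I -> lie_solvable I -> (I <= R)%VS].

Lemma memv_lie U V : {in U & V, forall u v, [lie u, v] \in lie_prodv U V}.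
Proof.
move=> u v /coord_vbasis-> /coord_vbasis->.
rewrite lie_suml; apply: memv_suml => i _.
rewrite lie_sumr; apply: memv_suml => j _.
rewrite lieZl lieZr !memvZ // memv_span //.
by apply/allpairsP; exists ((vbasis U)`_i, (vbasis V)`_j); rewrite !memt_nth.
Qed.

Lemma lie_prodvP {U V W} :
  reflect {in U & V, forall u v, [lie u, v] \in W} (lie_prodv U V <= W)%VS.
Proof.
apply: (iffP idP) => [sUVW u v Uu Vv | sUVW].
  by rewrite (subvP sUVW) ?memv_lie.
apply/span_subvP=> _ /allpairsP[[u v] /= [Uu Vv ->]].
by rewrite sUVW ?vbasis_mem.
Qed.

Lemma lie_prodvS U V U' V' :
  (U <= U')%VS -> (V <= V')%VS -> (lie_prodv U V <= lie_prodv U' V')%VS.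
Proof.
move=> /subvP sU /subvP sV; apply/lie_prodvP => u v Uu Vv.
by apply: memv_lie; [apply: sU | apply: sV].
Qed.

Lemma lie_derivedS n U V :
  (U <= V)%VS -> (lie_derived n U <= lie_derived n V)%VS.
Proof. by move=> sUV; elim: n => //= n IHn; apply: lie_prodvS. Qed.

Lemma lie_idealD I J : lie_ideal I -> lie_ideal J -> lie_ideal (I + J)%VS.
Proof.
move=> idI idJ x _ /memv_addP[u Iu [v Jv ->]].
by rewrite lieDr memv_add ?idI ?idJ.
Qed.

Lemma lie_derivedD n U J :
  lie_ideal J -> (lie_derived n (U + J) <= lie_derived n U + J)%VS.
Proof.
move=> idJ; elim: n => [|n IHn] //=; apply: subv_trans (lie_prodvS IHn IHn) _.
apply/lie_prodvP => _ _ /memv_addP[u Uu [v Jv ->]] /memv_addP[u' Uu' [v' Jv' ->]].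
rewrite lieDr lieDl -addrA memv_add ?memv_lie // memvD //.
  by rewrite lieC memvN idJ.
exact: idJ.
Qed.

Lemma lie_solvableD I J :
  lie_ideal J -> lie_solvable I -> lie_solvable J -> lie_solvable (I + J)%VS.
Proof.
move=> idJ [n solI] [m solJ]; exists (m + n)%N; apply/eqP.
rewrite -subv0 -solJ /lie_derived iterD; apply: lie_derivedS.
by apply: subv_trans (lie_derivedD n I idJ) _; rewrite solI add0v.
Qed.

Lemma solvable_radical_unique R R' :
  is_solvable_radical R -> is_solvable_radical R' -> R = R'.
Proof.
move=> [iR sR maxR] [iR' sR' maxR']; apply/eqP.
by rewrite eqEsubv maxR' // maxR.
Qed.

Lemma solvable_radical_exists : exists R, is_solvable_radical R.
Proof.
pose S I := lie_ideal I /\ lie_solvable I.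
have S0 : S 0%VS.
  by split=> [x y|]; [rewrite memv0 => /eqP->; rewrite lie0r mem0v | exists 0].
suff H n I : S I -> (\dim {:L} <= \dim I + n)%N -> exists R, is_solvable_radical R.
  exact: (H _ _ S0 (leq_addl _ _)).
elim: n I => [|n IHn] I SI dimI;
  case: (classic (is_solvable_radical I)) => [|notR]; try by exists I.
  exists I; split; [by case: SI | by case: SI | move=> J _ _].
  suff /eqP-> : I == fullv by apply: subvf.
  by rewrite eqEdim subvf -[\dim I]addn0.
have [J SJ nsJI] : exists2 J, S J & ~~ (J <= I)%VS.
  apply: NNPP => noJ; case: notR; split; try by case: SI.
  by move=> J iJ sJ; apply/negPn/negP => nsJI; case: noJ; exists J.
have [[iI sI] [iJ sJ]] := (SI, SJ).
apply: (IHn (I + J)%VS); first by split; [apply: lie_idealD | apply: lie_solvableD].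
apply: leq_trans dimI _; rewrite addnS -addSn leq_add2r.
rewrite ltn_neqAle dimvS ?addvSl // andbT.
apply: contra nsJI => dimE.
have /eqP -> : I == (I + J)%VS by rewrite eqEdim addvSl (eqP dimE) /=.
exact: addvSr.
Qed.

End Radical.

(* Indexed from 1 as in v_1 = x, v_(n+1) = [v_n, [x, y]]; the value at n = 0
   is junk and is excluded in [v_engel]. *)
Definition v_seq (k : fieldType) (L : lieAlgType k) (n : nat) (x y : L) : L :=
  iter n.-1 (fun z => [lie z, [lie x, y]]) x.

Definition v_engel (k : fieldType) (L : lieAlgType k) (y : L) : Prop :=
  forall x : L, exists2 n : nat, (1 <= n)%N & v_seq n x y = 0.

(* Main.v *)
From HB Require Import structures.
Require Import Defs.
From mathcomp Require Import all_boot all_order all_algebra all_field.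
From mathcomp Require Import ring.
From Stdlib Require Import Classical.

(* Everything rests on one trace argument (commutator_sum_nilpotent): a matrix
   A = \sum_i [X_i, Y_i] in characteristic zero is nilpotent as soon as
   tr (Y_i * ad_A^j X_i) = 0 for all large j.  Over a splitting field, let B act
   on the generalised eigenspace of A for l as q(l), where q is a nonzero Q-linear
   functional on the span of the eigenvalues; then ad_B = g(ad_A) with g divisible
   by a high power of 'X, so tr (A B) = 0, that is, \sum_l m_l l q(l) = 0 with m_l
   the multiplicities; applying q gives \sum_l m_l q(l)^2 = 0, a contradiction.

   - Let z = [x, y]. If ad_z^n x acts as zero on a subquotient of L, the criterion
     shows that z acts nilpotently on it. For y in R this applies to the
     subquotients R^(i) / R^(i+1) in turn and pushes ad_z^n x down the derived
     series of R, so that y is Engel.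
   - If y is Engel, every [x, y] acts nilpotently on L / R. With T the trace form
     of L / R, polarising T([x, y], [x, y]) = 0 puts all [y, [x, y]] in the kernel
     J of T. The criterion and an Engel argument show that J is solvable (Cartan),
     so J <= R. Hence y acts on L / R by some Y with Y^2 = 0 and Y X Y = 0 for
     every X in the image of L, so T(x, y) = 0 for all x and y \in J <= R. *)

Set Implicit Arguments.
Unset Strict Implicit.
Unset Printing Implicit Defensive.

Import Order.TTheory GRing.Theory Num.Theory VectorInternalTheory.

Local Open Scope ring_scope.

(** * Integer-valued functionals on finitely many elements of a field *)

Section CharZero.

Variables (K : fieldType) (charK : [pchar K] =i pred0).

Lemma pchar0_intr_eq0 (z : int) : (z%:~R == 0 :> K) = (z == 0).
Proof.
case: z => n; first by rewrite -pmulrn; move/pcharf0P: charK => ->.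
by rewrite NegzE mulrNz !oppr_eq0 -pmulrn; move/pcharf0P: charK => ->.
Qed.

(* If some relation has a nonzero coefficient at the first element, q is extended
   from the others through it; otherwise the first coordinate works. *)
Lemma integral_functional n (lam : 'I_n -> K) :
  (exists i, lam i != 0) ->
  exists q : 'I_n -> int, (exists i, q i != 0) /\
    forall c : 'I_n -> int,
      \sum_i (c i)%:~R * lam i = 0 -> \sum_i c i * q i = 0.
Proof.
elim: n lam => [|n IHn] lam [i0 lam_i0]; first by case: i0 lam_i0.
case: (classic (exists c : 'I_n.+1 -> int,
  c ord0 != 0 /\ \sum_i (c i)%:~R * lam i = 0)) => [[c [c0 rel_c]]|indep].
  rewrite big_ord_recl in rel_c.
  have [|q [[j qj] qP]] := IHn (fun i => lam (lift ord0 i)).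
    apply: NNPP => no_nz; case/negP: lam_i0.
    have lam0 j : lam (lift ord0 j) = 0.
      by apply/eqP/negPn/negP => nz; case: no_nz; exists j.
    have [j ->|->] := unliftP ord0 i0; first by rewrite lam0.
    move: rel_c; rewrite big1 => [|j _]; last by rewrite lam0 mulr0.
    rewrite addr0 => /eqP; rewrite mulf_eq0 pchar0_intr_eq0.
    by rewrite (negPf c0).
  exists (fun i => if unlift ord0 i is Some j then c ord0 * q j
                   else - \sum_j c (lift ord0 j) * q j); split.
    by exists (lift ord0 j); rewrite liftK mulf_neq0.
  move=> d; rewrite big_ord_recl => rel_d.
  rewrite big_ord_recl unlift_none.
  (* This combination eliminates [lam ord0] between [rel_c] and [rel_d], leaving a relation among
     the other elements. *)
  have := qP (fun i => c ord0 * d (lift ord0 i) - d ord0 * c (lift ord0 i)).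
  have splitE (R : comPzRingType) (a b : R) (f g h : 'I_n -> R) :
      \sum_i (a * f i - b * g i) * h i =
      a * (\sum_i f i * h i) - b * (\sum_i g i * h i).
    rewrite !mulr_sumr -sumrB; apply: eq_bigr => i _.
    by rewrite mulrBl !mulrA.
  rewrite splitE; under eq_bigr => i _ do rewrite rmorphB !rmorphM /=.
  rewrite splitE => qE.
  rewrite mulrN addrC (_ : \sum_(i < n) _ =
    c ord0 * \sum_(i < n) d (lift ord0 i) * q i); last first.
    by rewrite mulr_sumr; apply: eq_bigr => i _; rewrite liftK mulrCA.
  apply: qE; move/eqP: rel_c; rewrite addrC addr_eq0 => /eqP ->.
  by move/eqP: rel_d; rewrite addrC addr_eq0 => /eqP ->; ring.
exists (fun i => (i == ord0)%:R); split.
  by exists ord0.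
move=> c rel_c; rewrite (bigD1 ord0) //= mulr1 big1 => [|i /negPf->]; last first.
  by rewrite mulr0.
by rewrite addr0; apply/eqP/negPn/negP => c0; case: indep; exists c.
Qed.

End CharZero.

(** * Traces of nilpotent and idempotent matrices *)

Section Trace.

Variable K : fieldType.

(** Induction on the size: in a rank factorisation [A = C *m R], the smaller matrix [R *m C] has the
    same trace and is again nilpotent. At full rank [A] is a unit, so the size is 0. *)
Lemma mxtrace_nilpotent n (A : 'M[K]_n) m : A ^+ m = 0 -> \tr A = 0.
Proof.
elim/ltn_ind: n A m => n IHn A m Am0.
have [rk_lt|] := ltnP (\rank A) n.
  have AE := mulmx_base A; set C := col_base A in AE; set R := row_base A in AE.
  rewrite -AE mxtrace_mulC; apply: (IHn _ rk_lt (R *m C) m.+1).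
  have RX j : (R *m C) ^+ j *m R = R *m A ^+ j.
    elim: j => [|j IHj]; first by rewrite !expr0 mul1mx mulmx1.
    rewrite !exprSr -!mulmxE (_ : _ *m R = (R *m C) ^+ j *m R *m (C *m R)).
      by rewrite AE IHj mulmxA.
    by rewrite !mulmxA.
  by rewrite exprSr -mulmxE mulmxA RX Am0 mulmx0 mul0mx.
case: n {IHn} A Am0 => [|n] A Am0 rk_ge; first by rewrite [A]flatmx0 mxtrace0.
have: A \is a GRing.unit.
  by rewrite -[_ \is a _]/(A \in unitmx) -row_free_unit -row_leq_rank.
by move/(unitrX m); rewrite Am0 unitr0.
Qed.

(** With [E = C *m R] a rank factorisation, cancelling [C] and [R] in [E *m E = E] leaves
    [R *m C = 1%:M], of size [\rank E]. *)
Lemma mxtrace_idempotent n (E : 'M[K]_n) : E *m E = E -> \tr E = (\rank E)%:R.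
Proof.
move=> EE; have CR := mulmx_base E.
have [C' C'C] := row_fullP (col_base_full E).
have [R' RR'] := row_freeP (row_base_free E).
move: (col_base E) (row_base E) CR C'C RR' => C R CR C'C RR'.
rewrite -{1}CR mxtrace_mulC.
suff ->: R *m C = 1%:M by rewrite mxtrace1.
move: EE; rewrite -{1 2 3}CR => /(congr1 (fun M => C' *m M *m R')).
by rewrite !mulmxA C'C mul1mx -!mulmxA RR' !mulmx1.
Qed.

End Trace.

(** * Polynomials in an endomorphism *)

Section PolynomialAction.

Variables (K : fieldType) (V : lmodType K) (D : {linear V -> V}).

Definition poly_act (p : {poly K}) (v : V) : V :=
  \sum_(i < size p) p`_i *: iter i D v.

Lemma poly_act_wide (p : {poly K}) v m : (size p <= m)%N ->
  poly_act p v = \sum_(i < m) p`_i *: iter i D v.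
Proof.
move=> le_pm; rewrite /poly_act (big_ord_widen _ (fun i => p`_i *: iter i D v) le_pm).
rewrite big_mkcond; apply: eq_bigr => i _; case: ltnP => // le_pi.
by rewrite nth_default ?scale0r.
Qed.

Lemma poly_actDl p q v : poly_act (p + q) v = poly_act p v + poly_act q v.
Proof.
set m := maxn (size p) (size q).
rewrite (@poly_act_wide p v m) ?leq_maxl // (@poly_act_wide q v m) ?leq_maxr //.
rewrite (@poly_act_wide _ v m) ?size_polyD // -big_split /=.
by apply: eq_bigr => i _; rewrite coefD scalerDl.
Qed.

Lemma iter_linear i : linear (iter i D).
Proof. by elim: i => [|i IHi] a u v //; rewrite !iterS IHi linearP. Qed.

Lemma poly_act_linear p : linear (poly_act p).
Proof.
move=> a u v; rewrite /poly_act scaler_sumr -big_split /=; apply: eq_bigr => i _.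
by rewrite iter_linear scalerDr !scalerA [a * _]mulrC.
Qed.

HB.instance Definition _ p :=
  GRing.isLinear.Build K V V *:%R (poly_act p) (poly_act_linear p).

Lemma poly_actC c v : poly_act c%:P v = c *: v.
Proof. by rewrite (@poly_act_wide _ v 1) ?size_polyC_leq1 // big_ord1 coefC. Qed.

Lemma poly_actMX p v : poly_act (p * 'X) v = poly_act p (D v).
Proof.
rewrite (@poly_act_wide (p * 'X) v (size p).+1).
  rewrite big_ord_recl coefMX scale0r add0r; apply: eq_bigr => i _.
  by rewrite coefMX /= -iterS iterSr.
have [->|nz_p] := eqVneq p 0; first by rewrite mul0r size_poly0.
by rewrite size_mulX.
Qed.

Lemma poly_act_comm p v : poly_act p (D v) = D (poly_act p v).
Proof.
rewrite /poly_act linear_sum; apply: eq_bigr => i _.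
by rewrite linearZ -iterS iterSr.
Qed.

Lemma poly_actZ c p v : poly_act (c *: p) v = c *: poly_act p v.
Proof.
rewrite (@poly_act_wide _ v (size p)) ?size_scale_leq // /poly_act scaler_sumr.
by apply: eq_bigr => i _; rewrite coefZ scalerA.
Qed.

Lemma poly_actM p q v : poly_act (p * q) v = poly_act p (poly_act q v).
Proof.
elim/poly_ind: p v => [|p c IHp] v.
  by rewrite mul0r /poly_act size_poly0 !big_ord0.
rewrite mulrDl !poly_actDl mulrAC !poly_actMX IHp poly_act_comm poly_actC.
by rewrite mul_polyC poly_actZ.
Qed.

End PolynomialAction.

(** * Chinese remaindering for powers of linear factors *)

Section Coprime.

Variable K : fieldType.

Lemma coprime_prod_XsubC_exp (s : seq K) a N : a \notin s ->
  coprimep (('X - a%:P) ^+ N) (\prod_(b <- s) ('X - b%:P) ^+ N).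
Proof.
elim: s => [|b s IHs]; first by rewrite big_nil coprimep1.
rewrite inE negb_or => /andP[ab /IHs cop_s]; rewrite big_cons coprimepMr cop_s.
by rewrite andbT coprimep_expl // coprimep_expr // coprimep_XsubC2 // subr_eq0 eq_sym.
Qed.

Lemma poly_interpolation (s : seq K) N (c : K -> K) : uniq s ->
  exists g : {poly K}, {in s, forall a, ('X - a%:P) ^+ N %| g - (c a)%:P}.
Proof.
elim: s => [|b s IHs] /=; first by exists 0.
case/andP=> notsb /IHs[g gP].
have /Bezout_eq1_coprimepP[[u1 u2] /= uE] := coprime_prod_XsubC_exp N notsb.
(* By [uE], [u2] times the product is 1 modulo the power at [b], and it is 0 modulo the others: the
   residue at [b] is corrected without disturbing the rest. *)
exists (g + ((c b)%:P - g) * (u2 * \prod_(b <- s) ('X - b%:P) ^+ N)) => a.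
rewrite inE; have [-> _|_ /= sa] := eqVneq a b.
  rewrite [X in _ %| X](_ : _ = (g - (c b)%:P) * (u1 * ('X - b%:P) ^+ N)).
    by rewrite !dvdp_mull.
  move: uE; set P := \prod_(_ <- _) _ => /eqP.
  by rewrite addrC eq_sym -subr_eq => /eqP <-; ring.
rewrite addrAC dvdp_add ?gP //. do 2 apply: dvdp_mull.
by rewrite (big_rem a) //= dvdp_mulr.
Qed.

Lemma dvdp_prod_XsubC_exp (s : seq K) N (p : {poly K}) : uniq s ->
  {in s, forall a, ('X - a%:P) ^+ N %| p} ->
  \prod_(a <- s) ('X - a%:P) ^+ N %| p.
Proof.
elim: s => [|b s IHs] /=; first by rewrite big_nil dvd1p.
case/andP=> notsb Us sP; rewrite big_cons Gauss_dvdp ?coprime_prod_XsubC_exp //.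
by rewrite sP ?mem_head // IHs // => a sa; rewrite sP // inE sa orbT.
Qed.

(** No multiplicity in [t] exceeds [size t]. This brings a split characteristic polynomial to the
    form of [A_root] below. *)
Lemma prod_XsubC_dvd_undup (t : seq K) N : (size t <= N)%N ->
  \prod_(a <- t) ('X - a%:P) %| \prod_(a <- undup t) ('X - a%:P) ^+ N.
Proof.
move=> le_tN; rewrite -big_undup_iterop_count.
elim/big_ind2: _ => // [p q p' q'|a _]; first exact: dvdp_mul.
by rewrite Monoid.iteropE iter_mulr_1 dvdp_exp2l // (leq_trans (count_size _ _)).
Qed.

End Coprime.

(** * Generalised eigenvectors of [adr A] *)

Section Replica.

Variables (K : fieldType) (n : nat).

(* Commutation with A on the right, matching the row-vector convention: elements of
   L act by u |-> [u, x]. *)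
Definition adr (A U : 'M[K]_n) : 'M[K]_n := U *m A - A *m U.

Lemma adr_linear A : linear (adr A).
Proof.
move=> a U V; rewrite /adr mulmxDl mulmxDr -scalemxAl -scalemxAr scalerBr.
by rewrite opprD addrACA.
Qed.

HB.instance Definition _ A :=
  GRing.isLinear.Build K 'M[K]_n 'M[K]_n *:%R (adr A) (adr_linear A).

(** The factor ['X - (b - a)%:P] sends [U] to [U *m (A - b%:M) - (A - a%:M) *m U]. The first term
    lowers [j], the second lowers [i]; hence the induction on [i + j]. *)
Lemma adr_generalized_eigen (A : 'M[K]_n) a b i j U :
  (A - a%:M) ^+ i *m U = 0 -> U *m (A - b%:M) ^+ j = 0 ->
  poly_act (adr A) (('X - (b - a)%:P) ^+ (i + j)) U = 0.
Proof.
have [m] := ubnP (i + j); elim: m i j U => // m IHm i j U.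
case: i => [|i]; first by rewrite expr0 mul1mx => _ -> _; rewrite linear0.
case: j => [|j]; first by rewrite expr0 mulmx1 => _ _ ->; rewrite linear0.
rewrite addSn ltnS addnS => lt_ij AU UA; rewrite exprSr poly_actM.
have -> : poly_act (adr A) ('X - (b - a)%:P) U =
          U *m (A - b%:M) - (A - a%:M) *m U.
  rewrite poly_actDl -polyCN poly_actC -[X in poly_act _ X]mul1r.
  rewrite poly_actMX (poly_actC _ 1) scale1r /= /adr mulmxBr mulmxBl.
  rewrite mul_mx_scalar mul_scalar_mx !opprB scalerBl addrACA [RHS]addrACA.
  by rewrite [- (A *m U) - _]addrC.
rewrite linearB /= -{1}addSn -addnS.
rewrite (IHm i.+1 j) ?(IHm i j.+1) ?subr0 ?addnS //.
- by rewrite mulmxA -[_ *m (A - a%:M)]exprSr.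
- by rewrite -mulmxA UA mulmx0.
- by rewrite mulmxA AU mul0mx.
- by rewrite -mulmxA -[_ *m _ ^+ j]exprS.
Qed.

End Replica.

(** * Replicas of a matrix with split spectrum *)

Section SplitReplica.

Variables (K : fieldType) (charK : [pchar K] =i pred0) (n : nat).
Variables (A : 'M[K]_n.+1) (s : seq K) (N : nat).
Hypotheses (Us : uniq s) (N_gt0 : (0 < N)%N).
Hypothesis A_root : horner_mx A (\prod_(a <- s) ('X - a%:P) ^+ N) = 0.
Hypothesis s_eigen : {in s, forall a, eigenvalue A a}.

Let r := size s.
Let lam (i : 'I_r) := s`_i.

Let lam_eq i j : (lam i == lam j) = (i == j).
Proof. by rewrite nth_uniq. Qed.

Let s_lam i : lam i \in s. Proof. exact: mem_nth. Qed.

Let lamP a : a \in s -> exists i, a = lam i.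
Proof.
by move=> sa; exists (Ordinal (etrans (index_mem a s) sa)); rewrite /lam nth_index.
Qed.

Let horner_mx_dvd (p : {poly K}) :
  (forall i, ('X - (lam i)%:P) ^+ N %| p) -> horner_mx A p = 0.
Proof.
move=> dvd_p; have: \prod_(a <- s) ('X - a%:P) ^+ N %| p.
  by apply: dvdp_prod_XsubC_exp => // a /lamP[i ->].
by case/dvdpP=> h ->; rewrite rmorphM /= A_root mulr0.
Qed.

(** [E i] is a polynomial [e i] in [A], with [e i] congruent to 1 modulo the power at [lam i] and to
    0 modulo the others, so the identities reduce to divisibilities. It is nonzero because it fixes
    the eigenvectors for [lam i]. *)
Lemma primary_projectors : exists E : 'I_r -> 'M[K]_n.+1,
  [/\ \sum_i E i = 1%:M,
      forall i j, E i *m E j = if i == j then E i else 0,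
      forall i, A *m E i = E i *m A,
      forall i, (A - (lam i)%:M) ^+ N *m E i = 0
    & forall i, E i != 0].
Proof.
have /fin_all_exists[e eP] i : exists p : {poly K},
    forall j, ('X - (lam j)%:P) ^+ N %| p - (j == i)%:R%:P.
  have [p pP] := poly_interpolation N (fun b => (b == lam i)%:R) Us.
  by exists p => j; rewrite -lam_eq pP.
exists (fun i => horner_mx A (e i)); split.
- apply/eqP; rewrite -subr_eq0 -(rmorph_sum (horner_mx A)).
  rewrite -[1%:M](rmorph1 (horner_mx A)) -rmorphB; apply/eqP/horner_mx_dvd => j.
  have -> : \sum_i e i - 1 = \sum_i (e i - (j == i)%:R%:P).
    rewrite sumrB; congr (_ - _); rewrite (bigD1 j) //= eqxx big1 ?addr0 // => i.
    by rewrite eq_sym => /negPf->.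
  by elim/big_ind: _ => [|p1 p2|i _]; [exact: dvdp0 | exact: dvdp_add | exact: eP].
- move=> i j; have [<-|ij] := eqVneq i j; apply/eqP.
    rewrite -subr_eq0 mulmxE -rmorphM -rmorphB /=; apply/eqP/horner_mx_dvd => l.
    have := eP i l; have [->|_] := eqVneq l i => dvd_e.
      by rewrite -{3}[e i]mul1r -mulrBl dvdp_mulr.
    by rewrite -{3}[e i]mul1r -mulrBl dvdp_mull //; rewrite subr0 in dvd_e.
  rewrite mulmxE -rmorphM /=; apply/eqP/horner_mx_dvd => l.
  have := eP i l; have := eP j l.
  have [->|_] := eqVneq l i; last by rewrite subr0 => _; apply: dvdp_mulr.
  by rewrite (negPf ij) subr0 => dvd_e _; apply: dvdp_mull.
- by move=> i; apply/esym/comm_horner_mx; apply: comm_mx_refl.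
- move=> i; have <- : horner_mx A (('X - (lam i)%:P) ^+ N) = (A - (lam i)%:M) ^+ N.
    by rewrite rmorphXn rmorphB /= horner_mx_X horner_mx_C.
  rewrite mulmxE -rmorphM; apply: horner_mx_dvd => j.
  have [->|ji] := eqVneq j i; first exact: dvdp_mulr.
  by have := eP i j; rewrite (negPf ji) subr0; apply: dvdp_mull.
- move=> i; have /eigenvalueP[v vA nz_v] := s_eigen (s_lam i).
  apply: contra nz_v => /eqP E0.
  have: 'X - (lam i)%:P %| e i - 1.
    have := eP i i; rewrite eqxx; apply: dvdp_trans.
    by rewrite -(prednK N_gt0) exprS dvdp_mulr.
  case/dvdpP=> h /(congr1 (horner_mx A)); rewrite rmorphB rmorph1 /= E0 sub0r.
  rewrite mulrC rmorphM rmorphB /= horner_mx_X horner_mx_C.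
  move/(congr1 (mulmx v)); rewrite mulmxN mulmx1 -mulmxE mulmxA mulmxBr vA.
  by rewrite mul_mx_scalar subrr mul0mx => /eqP; rewrite oppr_eq0.
Qed.

(* B is a replica of A in the sense of Chevalley. The polynomial g interpolates
   the differences q(b) - q(a) at the eigenvalues b - a of ad_A. *)
Lemma replica_exists m : (exists2 a, a \in s & a != 0) ->
  exists (B : 'M[K]_n.+1) (g : {poly K}),
  [/\ forall i, (i < m)%N -> g`_i = 0,
      forall X, adr B X = poly_act (adr A) g X
    & \tr (A *m B) != 0].
Proof.
case=> _ /lamP[i0 ->] nz_i0.
have [E [sumE orthE commE genE nzE]] := primary_projectors.
have [|q [[j0 nz_q] qP]] := integral_functional charK (lam := lam).
  by exists i0.
pose B := \sum_i (q i)%:~R *: E i.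
(* Any pair representing [d] may be picked: [cE] shows that the value does not depend on it. The
   default 0 is never reached for a difference of eigenvalues. *)
pose c d : K := if [pick ij : 'I_r * 'I_r | lam ij.2 - lam ij.1 == d] is Some ij
                then (q ij.2 - q ij.1)%:~R else 0.
(* Coefficients of the relation [lam l - lam k - lam j + lam i = 0], wanted both in [int] and in
   [K]. *)
pose d4 (R : pzRingType) (i j k l x : 'I_r) : R :=
    (x == l)%:R - (x == k)%:R - (x == j)%:R + (x == i)%:R.
have sum_d4 (R : pzRingType) (f : 'I_r -> R) i j k l :
    \sum_x d4 R i j k l x * f x = f l - f k - f j + f i.
  have sum_delta y : \sum_x (x == y)%:R * f x = f y.
    rewrite (bigD1 y) //= eqxx mul1r big1 ?addr0 // => x /negPf->.
    by rewrite mul0r.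
  under eq_bigr => x _ do rewrite mulrDl !mulrBl.
  by rewrite big_split !sumrB /= !sum_delta.
have cE i j : c (lam j - lam i) = (q j - q i)%:~R.
  rewrite /c; case: pickP => [[k l] /= /eqP lamE|/(_ (i, j))]; last first.
    by rewrite eqxx.
  have /eqP : \sum_x d4 int i j k l x * q x = 0.
    apply: qP; rewrite (eq_bigr (fun x => d4 K i j k l x * lam x)) => [|x _].
      by rewrite sum_d4 lamE; ring.
    by rewrite rmorphD !rmorphB /= !rmorph_nat.
  by rewrite sum_d4 -addrA [- q j + _]addrC -(opprB (q j)) subr_eq0 => /eqP <-.
(* The exponent [N + N] annihilates each block [E i *m X *m E j]; the extra [m], at the difference 0
   where [c] vanishes, removes the low coefficients of [g]. *)
have [g gP] := poly_interpolation (N + N + m) c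
  (undup_uniq [seq lam j - lam i | i <- enum 'I_r, j <- enum 'I_r]).
have {}gP i j : ('X - (lam j - lam i)%:P) ^+ (N + N + m) %| g - (q j - q i)%:~R%:P.
  rewrite -cE; apply: gP; rewrite mem_undup.
  by apply: (allpairs_f (fun i j => lam j - lam i)); rewrite mem_enum.
exists B, g; split.
- move=> i lt_im; have := gP i0 i0; rewrite !subrr !subr0 => /dvdpP[h ->].
  by rewrite coefMXn ltn_addl.
- move=> X; rewrite -[X]mul1mx -[1%:M *m X]mulmx1 -sumE.
  rewrite mulmx_suml mulmx_suml !linear_sum /=; apply: eq_bigr => i _.
  rewrite mulmx_sumr !linear_sum /=; apply: eq_bigr => j _.
  set U := E i *m X *m E j.
  have EB l : E l *m B = (q l)%:~R *: E l.
    rewrite mulmx_sumr (bigD1 l) //= -scalemxAr orthE eqxx big1 ?addr0 // => k.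
    by rewrite eq_sym -scalemxAr orthE => /negPf->; rewrite scaler0.
  have BE l : B *m E l = (q l)%:~R *: E l.
    rewrite mulmx_suml (bigD1 l) //= -scalemxAl orthE eqxx big1 ?addr0 // => k.
    by rewrite -scalemxAl orthE => /negPf->; rewrite scaler0.
  have -> : adr B U = (q j - q i)%:~R *: U.
    rewrite /adr /U -[_ *m B]mulmxA EB !mulmxA BE -!scalemxAl -scalemxAr.
    by rewrite rmorphB scalerBl.
  have /dvdpP[h /eqP] := gP i j; rewrite subr_eq => /eqP->.
  rewrite poly_actDl poly_actC exprD [_ ^+ (N + N) * _]mulrC mulrA poly_actM.
  rewrite adr_generalized_eigen ?linear0 ?add0r //.
    by rewrite /U !mulmxA genE !mul0mx.
  have commEN : (A - (lam j)%:M) ^+ N *m E j = E j *m (A - (lam j)%:M) ^+ N.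
    suff: GRing.comm (E j) (A - (lam j)%:M) by move/(commrX N); apply: esym.
    by rewrite /GRing.comm -!mulmxE mulmxBr mulmxBl commE scalar_mxC.
  by rewrite /U -mulmxA -commEN genE mulmx0.
(* On the image of [E i], [A] is [lam i] plus a nilpotent part, which has trace zero. *)
- have trE i : \tr (A *m E i) = (\rank (E i))%:R * lam i.
    have -> : A *m E i = lam i *: E i + (A - (lam i)%:M) *m E i.
      by rewrite mulmxBl mul_scalar_mx addrC subrK.
    rewrite mxtraceD mxtraceZ mxtrace_idempotent; last by rewrite orthE eqxx.
    rewrite [\tr (_ *m _)](@mxtrace_nilpotent _ _ _ N) ?addr0 1?mulrC //.
    rewrite mulmxE exprMn_comm -?mulmxE; last first.
      by rewrite /GRing.comm -!mulmxE mulmxBr mulmxBl commE scalar_mxC.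
    by rewrite -(prednK N_gt0) [E i ^+ _]exprS -mulmxE mulmxA prednK // genE mul0mx.
  have -> : \tr (A *m B) = \sum_i (q i * (\rank (E i))%:R)%:~R * lam i.
    rewrite mulmx_sumr linear_sum /=; apply: eq_bigr => i _.
    by rewrite -scalemxAr mxtraceZ trE rmorphM /= rmorph_nat mulrA.
  apply/eqP => /qP /eqP.
  under eq_bigr => i _ do rewrite mulrAC -expr2.
  rewrite psumr_eq0 => [/allP/(_ j0 (mem_index_enum _))|i _]; last first.
    by rewrite mulr_ge0 ?sqr_ge0 ?ler0n.
  rewrite mulf_eq0 expf_eq0 (negPf nz_q) /= -[0]/(0%:R) eqr_nat mxrank_eq0.
  by rewrite (negPf (nzE j0)).
Qed.

End SplitReplica.

(** * Splitting fields *)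

Lemma irreducible_factor (F : fieldType) (p : {poly F}) : (1 < size p)%N ->
  exists2 q, irreducible_poly q & q %| p.
Proof.
have [m] := ubnP (size p); elim: m p => // m IHm p /ltnSE le_pm p_gt1.
case: (classic (irreducible_poly p)) => [irr_p|red_p]; first by exists p.
have nz_p : p != 0 by rewrite -size_poly_gt0 ltnW.
have [q [q_neq1 q_dv_p nqp]] :
    exists q : {poly F}, [/\ size q != 1, q %| p & ~~ (q %= p)].
  apply: NNPP => noq; apply: red_p; split=> // q q1 qp.
  by apply/negPn/negP => nqp; apply: noq; exists q.
have nz_q : q != 0 by apply: contraNneq nz_p => q0; rewrite q0 dvd0p in q_dv_p.
have q_gt1 : (1 < size q)%N by rewrite ltn_neqAle eq_sym q_neq1 size_poly_gt0.
have [|h irr_h hq] := IHm q _ q_gt1; last by exists h => //; apply: dvdp_trans q_dv_p.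
apply: leq_trans le_pm; rewrite ltn_neqAle dvdp_leq // andbT.
by rewrite dvdp_size_eqp.
Qed.

(** One root is adjoined and divided out at a time; the induction is on the size of the cofactor. *)
Lemma splitting_extension (F : fieldType) (p : {poly F}) : p != 0 ->
  exists (K : fieldType) (f : {rmorphism F -> K}) (t : seq K),
    map_poly f p %= \prod_(a <- t) ('X - a%:P).
Proof.
have [m] := ubnP (size p); elim: m F p => // m IHm F p /ltnSE le_pm nz_p.
have [p_le1|p_gt1] := leqP (size p) 1.
  exists F, idfun, [::]; rewrite big_nil map_poly_id // -size_poly_eq1.
  by rewrite eqn_leq p_le1 size_poly_gt0.
have [q irr_q q_dv_p] := irreducible_factor p_gt1.
have [L _ [z qz _]] := irredp_FAdjoin irr_q.
have /factor_theorem[h hE] : root (map_poly (in_alg L) p) z.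
  rewrite -dvdp_XsubCl; apply: (@dvdp_trans _ (map_poly (in_alg L) q)).
    by rewrite dvdp_XsubCl.
  by rewrite dvdp_map.
have nz_h : h != 0.
  by apply: contraNneq nz_p => h0; rewrite -(map_poly_eq0 (in_alg L)) hE h0 mul0r.
have [|K [f [t ft]]] := IHm L h _ nz_h.
  move: le_pm; rewrite -(size_map_poly (in_alg L)) hE size_Mmonic ?monicXsubC //.
  by rewrite size_XsubC addn2.
exists K, (f \o in_alg L), (f z :: t).
rewrite map_poly_comp hE rmorphM rmorphB /= map_polyX map_polyC /= big_cons.
by rewrite mulrC eqp_mull.
Qed.

(** * The trace criterion for nilpotency *)

Lemma map_adr (F K : fieldType) (f : {rmorphism F -> K}) n (A U : 'M[F]_n) j :
  iter j (adr (map_mx f A)) (map_mx f U) = map_mx f (iter j (adr A) U).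
Proof. by elim: j => //= j ->; rewrite /adr map_mxB !map_mxM. Qed.

Theorem commutator_sum_nilpotent (F : fieldType) (I : eqType) n (A : 'M[F]_n)
    (s : seq I) (X Y : I -> 'M[F]_n) m :
    [pchar F] =i pred0 ->
    A = \sum_(i <- s) (X i *m Y i - Y i *m X i) ->
    {in s, forall i j, (m <= j)%N -> \tr (Y i *m iter j (adr A) (X i)) = 0} ->
  exists N, A ^+ N = 0.
Proof.
move=> charF AE trA; case: n => [|n] in A X Y AE trA *.
  by exists 0; rewrite [LHS]flatmx0 [RHS]flatmx0.
have nz_chi : char_poly A != 0 by rewrite monic_neq0 ?char_poly_monic.
have [K [f [t]]] := splitting_extension nz_chi; rewrite map_char_poly => chi_eqp.
have charK : [pchar K] =i pred0 by move=> p; rewrite (fmorph_pchar f) charF.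
have {chi_eqp}chiE : char_poly (map_mx f A) = \prod_(a <- t) ('X - a%:P).
  apply/eqP; rewrite -eqp_monic ?char_poly_monic //.
  by apply: monic_prod_XsubC.
(* If 0 is the only eigenvalue, Cayley-Hamilton gives nilpotency; otherwise a replica leads to a
   contradiction. *)
case: (classic (exists2 a, a \in undup t & a != 0)) => [nz_t|t0]; last first.
  exists (size t); apply: (@map_mx_inj _ _ f); rewrite rmorphXn map_mx0 /=.
  rewrite -(Cayley_Hamilton (map_mx f A)) chiE.
  rewrite (@eq_big_seq _ _ _ _ _ _ (fun=> 'X)) => [|a ta].
    by rewrite big_const_seq count_predT iter_mulr_1 rmorphXn /= horner_mx_X.
  have /eqP-> : a == 0 by apply/negPn/negP => ?; apply: t0; exists a; rewrite ?mem_undup.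
  by rewrite subr0.
have root0 : horner_mx (map_mx f A)
    (\prod_(a <- undup t) ('X - a%:P) ^+ (size t).+1) = 0.
  have /dvdpP[h ->] := prod_XsubC_dvd_undup (leqnSn (size t)).
  by rewrite -chiE rmorphM /= Cayley_Hamilton mulr0.
have eig : {in undup t, forall a, eigenvalue (map_mx f A) a}.
  by move=> a; rewrite mem_undup eigenvalue_root_char chiE root_prod_XsubC.
have [B [g [g_lt_m gP /eqP[]]]] :=
  replica_exists charK (undup_uniq t) (ltn0Sn _) root0 eig m nz_t.
(* The trace of [(X Y - Y X) B] is minus that of [Y (adr B X)], and [adr B X] combines iterates of
   [adr A] on [X] of index at least [m], where [trA] applies. *)
rewrite {1}AE raddf_sum mulmx_suml raddf_sum /= big_seq big1 // => i si.
rewrite map_mxB !map_mxM mulmxBl raddfB /= -mulmxA mxtrace_mulC -!mulmxA.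
rewrite -raddfB /= -mulmxBr -opprB -/(adr B _) gP /poly_act mulmxN raddfN /= mulmx_sumr.
rewrite (raddf_sum (@mxtrace K n.+1)) /= big1 ?oppr0 // => j _.
have [/g_lt_m->|le_mj] := ltnP j m; first by rewrite scale0r mulmx0 raddf0.
by rewrite -scalemxAr map_adr -map_mxM mxtraceZ trace_map_mx trA ?rmorph0 ?mulr0.
Qed.

(** * Ideals, derived series and an Engel theorem *)

Section LieLemmas.

Variables (k : fieldType) (L : finDimLieAlgType k).
Implicit Types (x y z u v : L) (U V I J Q R : {vspace L}).

Definition subalgebra U := {in U &, forall u v, [lie u, v] \in U}.

Lemma lieNl x y : [lie - x, y] = - [lie x, y].
Proof. by rewrite -!scaleN1r lieZl. Qed.

Lemma lieNr x y : [lie x, - y] = - [lie x, y].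
Proof. by rewrite -!scaleN1r lieZr. Qed.

Lemma lieBl x y z : [lie x - y, z] = [lie x, z] - [lie y, z].
Proof. by rewrite lieDl lieNl. Qed.

Lemma lie_assocr x y z : [lie x, [lie y, z]] = [lie [lie x, y], z] - [lie [lie x, z], y].
Proof.
apply/eqP; rewrite -subr_eq0 opprB addrA; apply/eqP.
rewrite -(lie_jacobi x y z) (lieC z x) lieNr (lieC y [lie x, z]) opprK.
by rewrite (lieC z [lie x, y]).
Qed.

Lemma lie_idealr I x y : lie_ideal I -> x \in I -> [lie x, y] \in I.
Proof. by move=> idI Ix; rewrite lieC memvN idI. Qed.

Lemma lie_ideal_subalgebra I : lie_ideal I -> subalgebra I.
Proof. by move=> idI u v _ /idI. Qed.

(** Scalars are absorbed into the left factor of a bracket, so closure under sums is enough. *)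
Lemma lie_prodv_ind U V (P : L -> Prop) :
  P 0 -> (forall u v, P u -> P v -> P (u + v)) ->
  {in U & V, forall u v, P [lie u, v]} ->
  forall z, z \in lie_prodv U V -> P z.
Proof.
move=> P0 PD PUV z; set X := [seq [lie u, v] | u <- vbasis U, v <- vbasis V].
move=> Xz; rewrite (coord_span (X := in_tuple X) Xz).
elim/big_ind: _ => // i _.
have /allpairsP[[u v] /= [Uu Vv ->]] : X`_i \in X by apply: mem_nth.
by rewrite -lieZl; apply: PUV; rewrite ?memvZ ?vbasis_mem.
Qed.

Lemma lie_prodv_ideal I J : lie_ideal I -> lie_ideal J -> lie_ideal (lie_prodv I J).
Proof.
move=> idI idJ x; apply: lie_prodv_ind => [|u v Pu Pv|u v Iu Jv].
- by rewrite lie0r mem0v.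
- by rewrite lieDr memvD.
rewrite lie_assocr memvB //; first by rewrite memv_lie ?idI.
by rewrite lieC memvN memv_lie ?idJ.
Qed.

Lemma lie_derived_ideal i I : lie_ideal I -> lie_ideal (lie_derived i I).
Proof. by move=> idI; elim: i => //= i IHi; apply: lie_prodv_ideal. Qed.

Lemma lie_derived_decr i U : subalgebra U ->
  (lie_derived i.+1 U <= lie_derived i U)%VS.
Proof.
move=> algU; elim: i => [|i IHi]; last exact: lie_prodvS.
exact/lie_prodvP.
Qed.

Lemma lie_derived_sub i U : subalgebra U -> (lie_derived i U <= U)%VS.
Proof.
by move=> algU; elim: i => // i; apply: subv_trans; apply: lie_derived_decr.
Qed.

(** A common null vector of [Q] acting on [U / Q], found by climbing the derived series of [Q] from
    0. On the vectors killed by one term, the elements of the preceding, larger term act by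
    commuting nilpotent operators, which can be treated one at a time. *)
Lemma quotient_null_vector Q U : subalgebra Q -> lie_solvable Q ->
    subalgebra U -> (Q <= U)%VS -> ~~ (U <= Q)%VS ->
    {in Q & U, forall q v, exists n, iter n (fun t => [lie t, q]) v \in Q} ->
  exists2 a, a \in U & a \notin Q /\ {in Q, forall q, [lie a, q] \in Q}.
Proof.
move=> algQ [n solQ] algU /subvP sQU nUQ nilQ.
suff S i : (i <= n)%N -> exists2 a, a \in U &
    a \notin Q /\ {in lie_derived (n - i) Q, forall q, [lie a, q] \in Q}.
  by have := S n (leqnn n); rewrite subnn.
elim: i => [_|i IHi lt_in].
  have [a Ua nQa] := subvPn nUQ; exists a; rewrite // subn0 solQ; split=> // q.
  by rewrite memv0 => /eqP->; rewrite lie0r mem0v.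
have [a Ua [nQa aQ]] := IHi (ltnW lt_in).
rewrite -subSS subSn // in aQ; move: (n - i.+1)%N aQ => d aQ.
have sdQ q : q \in lie_derived d Q -> q \in Q by apply/subvP/lie_derived_sub.
have sdS q : q \in lie_derived d.+1 Q -> q \in lie_derived d Q.
  by apply/subvP/lie_derived_decr.
pose W (l : seq L) t := [/\ t \in U, {in lie_derived d.+1 Q, forall q, [lie t, q] \in Q}
  & {in l, forall q, [lie t, q] \in Q}].
have [b [Ub bQ bX] nQb] : exists2 b, W (vbasis (lie_derived d Q)) b & b \notin Q.
  suff gen (l : seq L) : {subset l <= lie_derived d Q} -> exists2 b, W l b & b \notin Q.
    by apply: gen => q; apply: vbasis_mem.
  elim: l => [_|c l IHl sl]; first by exists a.
  have [|b [Ub bQ bl] nQb] := IHl; first by move=> q lq; rewrite sl // inE lq orbT.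
  have dc : c \in lie_derived d Q by rewrite sl ?mem_head.
  have dl q : q \in l -> q \in lie_derived d Q by move=> lq; rewrite sl // inE lq orbT.
  (* The last iterate of [[lie _, c]] on [b] outside [Q] is killed by [c] modulo [Q]; by [Witer] it
     stays killed by the earlier elements [l]. *)
  have /ex_minnP[[|m] Qm min_m] := nilQ c b (sdQ c dc) Ub.
    by rewrite Qm in nQb.
  have Witer j : W l (iter j (fun t => [lie t, c]) b).
    elim: j => //= j; move: (iter j _ b) => t [Ut tQ tl].
    have key q : q \in lie_derived d Q -> [lie t, q] \in Q ->
        [lie [lie t, c], q] \in Q.
      move=> dq Qtq; have := lie_assocr t c q => /esym/eqP; rewrite subr_eq => /eqP->.
      by apply: memvD; [apply: tQ; apply: memv_lie | apply: algQ => //; apply: sdQ].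
    split=> [|q dq|q lq]; first by apply: algU => //; apply/sQU/sdQ.
      by rewrite key ?tQ ?sdS.
    by rewrite key ?tl ?dl.
  have [Ut tQ tl] := Witer m; exists (iter m (fun t => [lie t, c]) b).
    by split=> // q; rewrite inE => /predU1P[->|/tl].
  by apply/negP => /min_m; rewrite ltnn.
exists b => //; split=> // q /coord_vbasis->; rewrite lie_sumr memv_suml // => j _.
by rewrite lieZr memvZ // bX // memt_nth.
Qed.

(* A maximal solvable subalgebra Q of U containing R cannot be proper: a vector
   a \notin Q with [a, Q] <= Q would enlarge it. *)
Lemma engel_solvable R U : lie_ideal R -> lie_solvable R ->
    subalgebra U -> (R <= U)%VS ->
    {in U &, forall u v, exists n, iter n (fun t => [lie t, u]) v \in R} ->
  lie_solvable U.
Proof.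
move=> idR solR algU sRU nilU.
suff IH m Q : subalgebra Q -> lie_solvable Q -> (R <= Q)%VS -> (Q <= U)%VS ->
    (\dim U <= \dim Q + m)%N -> lie_solvable U.
  by apply: (IH (\dim U) R) => //; [apply: lie_ideal_subalgebra | apply: leq_addl].
elim: m Q => [|m IHm] Q algQ solQ sRQ sQU dimQ.
  by have /eqP<- : Q == U by rewrite eqEdim sQU -[\dim Q]addn0.
have [sUQ|nUQ] := boolP (U <= Q)%VS.
  by have /eqP<- : Q == U by rewrite eqEsubv sQU.
have [|a Ua [nQa aQ]] := quotient_null_vector algQ solQ algU sQU nUQ.
  move=> q v Qq Uv; have [n Rn] := nilU q v (subvP sQU q Qq) Uv.
  by exists n; apply: (subvP sRQ).
have prodQa : (lie_prodv (Q + <[a]>) (Q + <[a]>) <= Q)%VS.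
  apply/lie_prodvP => _ _ /memv_addP[q Qq [_ /vlineP[c ->] ->]]
    /memv_addP[q' Qq' [_ /vlineP[c' ->] ->]].
  rewrite lieDl !lieDr !lieZl !lieZr liexx !scaler0 addr0.
  by rewrite !memvD ?memvZ ?aQ ?(lieC q) ?memvN ?aQ //; apply: algQ.
have sQQa : (Q <= Q + <[a]>)%VS by apply: addvSl.
apply: (IHm (Q + <[a]>)%VS).
- move=> u v Uu Uv; apply/(subvP sQQa)/(subvP prodQa); exact: memv_lie.
- have [n Qn0] := solQ; exists n.+1; rewrite /lie_derived iterSr; apply/eqP.
  by rewrite -subv0 -Qn0; apply: lie_derivedS.
- exact: subv_trans sQQa.
- by rewrite subv_add sQU -memvE.
apply: leq_trans dimQ _; rewrite addnS -addSn leq_add2r ltn_neqAle dimvS // andbT.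
apply: contra nQa => dimE; have /eqP-> : Q == (Q + <[a]>)%VS.
  by rewrite eqEdim sQQa (eqP dimE) /=.
by rewrite memvE addvSr.
Qed.

End LieLemmas.

(** * The adjoint action on a subquotient *)

Section Subquotient.

Variables (k : fieldType) (L : finDimLieAlgType k) (I I' : {vspace L}).
Hypotheses (idI : lie_ideal I) (idI' : lie_ideal I') (sI'I : (I' <= I)%VS).
Implicit Types x y z u w : L.

(* A linear section of I -> I / I' followed by the projection: it identifies
   I / I' with a complement of I' in I and kills everything else. *)
Let e : 'End(L) := addv_pi1 I I'.

Let mem_e u : e u \in I. Proof. exact: memv_pi1. Qed.

Let e_mod u : u \in I -> u - e u \in I'.
Proof.
move=> Iu; have := @addv_pi1_pi2 _ _ I I' u; rewrite (addv_idPl sI'I) Iu => /(_ isT).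
by move=> {1}<-; rewrite addrAC subrr add0r memv_pi2.
Qed.

Let e_ker u : u \in I' -> e u = 0.
Proof.
move=> I'u; have := @addv_pi1_pi2 _ _ I I' u; rewrite (addv_idPl sI'I) (subvP sI'I) //.
by move=> /(_ isT); rewrite addv_pi2_id // => /(canRL (addrK _)); rewrite subrr.
Qed.

(** Working on all of [L] gives every subquotient matrices of the same size; acting through the
    projection changes neither traces nor nilpotency. *)
Definition subquo_fun x (r : 'rV[k]_(dim L)) : 'rV[k]_(dim L) :=
  v2r (addv_pi1 I I' [lie addv_pi1 I I' (r2v r), x]).

Lemma subquo_fun_linear x : linear (subquo_fun x).
Proof. by move=> a u w; rewrite /subquo_fun !linearP /= lieDl lieZl !linearP. Qed.

HB.instance Definition _ x := GRing.isLinear.Build k 'rV[k]_(dim L) 'rV[k]_(dim L)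
  *:%R (subquo_fun x) (subquo_fun_linear x).

Definition subquo_mx x : 'M[k]_(dim L) := lin1_mx (subquo_fun x).

Let mul_subquo u x : v2r u *m subquo_mx x = v2r (e [lie e u, x]).
Proof. by rewrite mul_rV_lin1 /= /subquo_fun v2rK. Qed.

Let eq_subquo (A B : 'M[k]_(dim L)) :
  (forall u : L, v2r u *m A = v2r u *m B) -> A = B.
Proof.
by move=> AB; apply/row_matrixP => i; rewrite !rowE -[delta_mx _ _]r2vK AB.
Qed.

Lemma mul_subquoM u x w :
  v2r u *m (subquo_mx x *m subquo_mx w) = v2r (e [lie [lie e u, x], w]).
Proof.
rewrite mulmxA !mul_subquo; congr v2r.
set t := [lie e u, x]; have It : t \in I by rewrite lie_idealr.
have : t - e (e t) \in I'.
  have -> : t - e (e t) = (t - e t) + (e t - e (e t)) by rewrite addrA subrK.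
  by rewrite memvD ?e_mod.
move=> /(lie_idealr w idI') /e_ker; rewrite lieBl linearB /=.
by move/eqP; rewrite subr_eq0 => /eqP->.
Qed.

Lemma subquo_mx_linear : linear subquo_mx.
Proof.
move=> a x w; apply: eq_subquo => u.
by rewrite mulmxDr -scalemxAr !mul_subquo lieDr lieZr !linearP.
Qed.

HB.instance Definition _ := GRing.isLinear.Build k L 'M[k]_(dim L) *:%R
  subquo_mx subquo_mx_linear.

Lemma subquo_mx_lie x w : subquo_mx [lie x, w] = adr (subquo_mx w) (subquo_mx x).
Proof.
apply: eq_subquo => u; rewrite mulmxBr !mul_subquoM mul_subquo lie_assocr.
by rewrite !linearB.
Qed.

Lemma subquo_mx_iter_lie n x z : subquo_mx (iter n (fun t => [lie t, z]) x) =
  iter n (adr (subquo_mx z)) (subquo_mx x).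
Proof. by elim: n => //= n <-; rewrite subquo_mx_lie. Qed.

Lemma subquo_mx_eq0 x : {in I, forall u, [lie u, x] \in I'} -> subquo_mx x = 0.
Proof.
move=> I'x; apply: eq_subquo => u.
by rewrite mul_subquo e_ker ?linear0 ?mulmx0 // I'x.
Qed.

Lemma subquo_mx_mul_eq0 x w : {in I, forall u, [lie [lie u, x], w] \in I'} ->
  subquo_mx x *m subquo_mx w = 0.
Proof.
move=> I'x; apply: eq_subquo => u.
by rewrite mul_subquoM e_ker ?linear0 ?mulmx0 // I'x.
Qed.

(** Iterated brackets agree with powers of the matrix modulo [I']; membership in [I] is carried
    along because [e_mod] requires it. *)
Lemma subquo_mx_nilpotent z N : subquo_mx z ^+ N = 0 ->
  {in I, forall u, iter N (fun t => [lie t, z]) u \in I'}.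
Proof.
move=> zN u Iu.
suff: iter N (fun t => [lie t, z]) u \in I /\
    iter N (fun t => [lie t, z]) u - r2v (v2r u *m subquo_mx z ^+ N) \in I'.
  by rewrite zN mulmx0 linear0 subr0 => -[].
elim: N {zN} => [|N [It Jt]]; first by rewrite mulmx1 v2rK subrr mem0v.
rewrite iterS exprSr -mulmxE mulmxA.
move: It Jt; move: (iter N _ u) (v2r u *m _) => t r It.
rewrite -{2}[r]r2vK mul_subquo v2rK; move: (r2v r) => {}r I'tr.
have Itz : [lie t, z] \in I by rewrite lie_idealr.
have Ir : r \in I by rewrite -[r](subKr t) memvB // (subvP sI'I).
split=> //; have -> : [lie t, z] - e [lie e r, z] =
    [lie (t - r) + (r - e r), z] + ([lie e r, z] - e [lie e r, z]).
  by rewrite [t - r + _]addrA subrK lieBl addrA subrK.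
by rewrite memvD ?e_mod ?lie_idealr // memvD // e_mod.
Qed.

Hypothesis chark : [pchar k] =i pred0.

(** The trace criterion for a single commutator: from index [n] on, the iterates act as zero, so the
    traces vanish. *)
Lemma subquo_mx_commutator_nilpotent n x y :
  {in I, forall u, [lie u, iter n (fun t => [lie t, [lie x, y]]) x] \in I'} ->
  exists N, subquo_mx [lie x, y] ^+ N = 0.
Proof.
move=> xn; apply: (@commutator_sum_nilpotent _ unit _ _ [:: tt]
  (fun=> subquo_mx x) (fun=> subquo_mx y) n) => //.
  by rewrite big_seq1 subquo_mx_lie.
move=> _ _ j /subnK<-; rewrite iterD -subquo_mx_iter_lie (subquo_mx_eq0 xn).
suff -> : iter (j - n) (adr (subquo_mx [lie x, y])) 0 = 0.
  by rewrite mulmx0 mxtrace0.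
by elim: (j - n)%N => //= i ->; rewrite linear0.
Qed.

End Subquotient.

(** * The radical and the Engel elements *)

Section RadicalCharacterization.

Variables (k : fieldType) (chark : [pchar k] =i pred0) (L : finDimLieAlgType k).
Variables (R : {vspace L}) (radR : is_solvable_radical R).
Implicit Types x y z u w : L.

Let idR : lie_ideal R. Proof. by case: radR. Qed.
Let solR : lie_solvable R. Proof. by case: radR. Qed.

Lemma solvable_radical_v_engel y : y \in R -> v_engel y.
Proof.
move=> Ry x; set z := [lie x, y].
have [d Rd0] := solR.
suff S i : exists n, iter n (fun t => [lie t, z]) x \in lie_derived i R.
  (* [v_seq] is indexed from 1, so the [n]-th iterate is its term [n.+1]. *)
  have [n] := S d; rewrite Rd0 memv0 => /eqP xn; exists n.+1 => //.
(* Since [z] lies in [R], a single bracket brings [x] into [R]. *)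
elim: i => [|i [n xn]]; first by exists 1; apply: idR; apply: idR.
have algR := lie_ideal_subalgebra idR.
have idRi := @lie_derived_ideal _ _ i R idR.
have idRSi := @lie_derived_ideal _ _ i.+1 R idR.
have sRi := @lie_derived_decr _ _ i R algR.
have [|N zN] := subquo_mx_commutator_nilpotent idRi idRSi sRi chark (n := n)
  (x := x) (y := y).
  by move=> u Iu; apply: memv_lie.
exists (N + n)%N; rewrite iterD.
exact: (subquo_mx_nilpotent idRi idRSi sRi zN xn).
Qed.

Let idT : lie_ideal (fullv : {vspace L}). Proof. by move=> x y _; apply: memvf. Qed.

Let rho := subquo_mx fullv R.

Let rho_lie x w : rho [lie x, w] = rho x *m rho w - rho w *m rho x.
Proof. exact: subquo_mx_lie idT idR (subvf R) x w. Qed.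

Definition trace_form x w := \tr (rho x *m rho w).

Lemma trace_formC x w : trace_form x w = trace_form w x.
Proof. exact: mxtrace_mulC. Qed.

Lemma trace_formDl x w u : trace_form (x + w) u = trace_form x u + trace_form w u.
Proof. by rewrite /trace_form /rho linearD mulmxDl mxtraceD. Qed.

Lemma trace_formZl a x u : trace_form (a *: x) u = a * trace_form x u.
Proof. by rewrite /trace_form /rho linearZ -scalemxAl mxtraceZ. Qed.

Lemma trace_form_lie x w u : trace_form [lie x, w] u = trace_form x [lie w, u].
Proof.
rewrite /trace_form !rho_lie mulmxBl mulmxBr !raddfB /= !mulmxA.
by congr (_ - _); rewrite -(mulmxA (rho w)) (mxtrace_mulC (rho w)).
Qed.

(** Coordinates of the linear form [trace_form x], which turn the kernel of the trace form into an
    [lker]. *)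
Definition trace_form_row x : 'rV[k]_(\dim {:L}) :=
  \row_i trace_form x (vbasis fullv)`_i.

Lemma trace_form_row_linear : linear trace_form_row.
Proof.
by move=> a x w; apply/rowP => i; rewrite !mxE trace_formDl trace_formZl.
Qed.

HB.instance Definition _ := GRing.isLinear.Build k L 'rV[k]_(\dim {:L}) *:%R
  trace_form_row trace_form_row_linear.

Let J := lker (linfun trace_form_row).

Let memJ x : reflect (forall w, trace_form x w = 0) (x \in J).
Proof.
rewrite memv_ker lfunE; apply: (iffP eqP) => [/= x0 w|x0]; last first.
  by apply/rowP => i; rewrite !mxE.
rewrite (coord_vbasis (memvf w)) trace_formC.
elim/big_ind: _ => [|u v u0 v0|i _].
- by rewrite -[0 in LHS](scale0r (0 : L)) trace_formZl mul0r.
- by rewrite trace_formDl u0 v0 addr0.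
by rewrite trace_formZl trace_formC; move/rowP/(_ i): x0; rewrite !mxE => ->; rewrite mulr0.
Qed.

Let idJ : lie_ideal J.
Proof.
move=> x y /memJ Jy; apply/memJ => w.
by rewrite lieC -scaleN1r trace_formZl trace_form_lie Jy mulr0.
Qed.

Lemma trace_form_kernel_sub_radical : (J <= R)%VS.
Proof.
have [_ _ maxR] := radR; apply: (maxR J idJ).
have idP := lie_prodv_ideal idJ idJ; set P := lie_prodv J J in idP.
(* The criterion speaks of sums of commutators, so it is applied on [P], the derived algebra of [J];
   one more derived step then covers [J]. *)
suff [n Pn0] : lie_solvable (P + R)%VS.
  exists n.+1; rewrite /lie_derived iterSr; apply/eqP; rewrite -subv0 -Pn0.
  by apply: lie_derivedS; apply: addvSl.
have idPR := lie_idealD idP idR.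
apply: (engel_solvable idR solR) => //; [exact: lie_ideal_subalgebra|exact: addvSr|].
move=> _ v /memv_addP[z Pz [w Rw ->]] _.
have {Pz} [s [sJ zE]] : exists s : seq (L * L),
    {in s, forall p, p.1 \in J /\ p.2 \in J} /\ z = \sum_(p <- s) [lie p.1, p.2].
  move: z Pz; apply: lie_prodv_ind => [|u1 u2 [s1 [s1J ->]] [s2 [s2J ->]]|a b Ja Jb].
  - by exists [::]; rewrite big_nil.
  - exists (s1 ++ s2); rewrite big_cat; split=> // p.
    by rewrite mem_cat => /orP[/s1J|/s2J].
  - by exists [:: (a, b)]; rewrite big_seq1; split=> // p; rewrite inE => /eqP->.
(* The bound is 0: [p.2] lies in the kernel of the trace form, so every trace vanishes. *)
have [|p sp j _|N zN] := @commutator_sum_nilpotent _ _ _ (rho z) s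
    (fun p => rho p.1) (fun p => rho p.2) 0 chark.
- by rewrite {1}zE /rho linear_sum; apply: eq_bigr => p _; apply: rho_lie.
- have [_ /memJ Jp2] := sJ p sp.
  by rewrite -subquo_mx_iter_lie //; [apply: Jp2 | apply: subvf].
exists N; apply: (subquo_mx_nilpotent idT idR (subvf R)) (memvf v).
suff -> : subquo_mx fullv R (z + w) = rho z by [].
rewrite linearD /= [subquo_mx _ _ w]subquo_mx_eq0 ?addr0 ?subvf // => u _.
exact: idR.
Qed.

Lemma v_engel_solvable_radical y : v_engel y -> y \in R.
Proof.
move=> engy; have sJR := subvP trace_form_kernel_sub_radical.
have nil x : exists N, rho [lie x, y] ^+ N = 0.
  have [[//|n] _ xn] := engy x.
  apply: (subquo_mx_commutator_nilpotent idT idR (subvf R) chark (n := n)) => u _.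
  by rewrite [iter _ _ _]xn lie0r mem0v.
have two_neq0 : (2%:R : k) != 0 by move/pcharf0P: chark => ->.
have trq x : trace_form [lie x, y] [lie x, y] = 0.
  have [N zN] := nil x; apply: (@mxtrace_nilpotent _ _ _ N).
  by rewrite mulmxE -expr2 -exprM mulnC exprM zN expr0n.
have yxy x : [lie y, [lie x, y]] \in J.
  (* The cross terms of [trq (w + x)] add up to [2 T([w, y], [x, y])], and invariance makes
     [T([w, y], [x, y])] equal to [T(w, [y, [x, y]])]. *)
  apply/memJ => w; rewrite trace_formC -trace_form_lie.
  have := trq (w + x); rewrite lieDl trace_formDl.
  rewrite ![trace_form _ (_ + _)]trace_formC !trace_formDl !trq add0r addr0.
  rewrite [trace_form [lie x, y] _]trace_formC -mulr2n -mulr_natl => /eqP.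
  by rewrite mulf_eq0 (negPf two_neq0) => /eqP.
have YY : rho y *m rho y = 0.
  apply: (subquo_mx_mul_eq0 idT idR (subvf R)) => u _.
  by rewrite lieC memvN sJR.
apply/(sJR y)/memJ => x; rewrite trace_formC.
(* Once [Y Y = 0], the double commutator [[Y, [X, Y]]] equals [2 Y X Y]. *)
have YXY : rho y *m rho x *m rho y = 0.
  have : rho [lie y, [lie x, y]] = 0.
    by apply: (subquo_mx_eq0 (subvf R)) => u _; apply: idR; apply: sJR.
  rewrite !rho_lie mulmxBr mulmxBl !mulmxA YY mul0mx subr0 -[X in _ - (X - _)]mulmxA YY.
  rewrite mulmx0 sub0r opprK -mulr2n -scaler_nat => /eqP.
  by rewrite scaler_eq0 (negPf two_neq0) => /eqP.
apply: (@mxtrace_nilpotent _ _ _ 2).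
by rewrite expr2 -mulmxE mulmxA -2!mulmxA [rho y *m _]mulmxA YXY mulmx0.
Qed.

End RadicalCharacterization.

Theorem theorem3p7 (k : fieldType) (hk : [pchar k] =i pred0)
    (L : finDimLieAlgType k) (R : {vspace L}) (hR : is_solvable_radical R) :
  forall y : L, y \in R <-> v_engel y.
Proof.
move=> y; split; first exact: solvable_radical_v_engel.
exact: v_engel_solvable_radical.
Qed.
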